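(* Let $K$ be an algebraically closed field of characteristic $2$. For every special spine $S$ of a compact connected $3$-manifold $M$, the set $W_\infty(S)$ is empty.
   Context: **Polyhedra and spines.** A simple polyhedron is a finite CW-complex $P$ each point of which has a neighbourhood homeomorphic to (1) a disc; or (2) three discs meeting along a common arc of their boundaries, with the point on this arc; or (3) the butterfly: four arcs meeting at the point, with a face running along each of the six pairs of arcs. Points of type (3) are true vertices. The 1-strata are the (open or closed) triple lines, and the 2-components are the connected components of the set of points of type (1). $P$ is special if each 1-stratum is an open 1-cell and each 2-component is an open 2-cell. A spine of a compact connected 3-manifold $M$ with nonempty boundary is a simple subpolyhedron $P\subset \mathrm{Int}\,M$ with $M\setminus P\cong\partial M\times[0,1)$; a spine of a closed connected $M$ is a spine of $M$ minus an open ball. **Solution sets.** For a simple polyhedron $S$ embedded in a 3-manifold, let $S_0$ be the set of true vertices and $S_2$ the set of 2-components (''2-cells''). Each $v\in S_0$ has six local sheets (pairs of arcs of the butterfly), falling into three pairs of opposite sheets (sheets sharing no arc). For $x=(x_\sigma)_{\sigma\in S_2}\in K^{S_2}$, $\Pi_v(x)=ac+bd+ef$, where $\{a,c\},\{b,d\},\{e,f\}$ are the weights $x_\sigma$ of the 2-components containing the opposite sheets at $v$ (2-components may repeat). Put $W(S)=\{x\in K^{S_2}: \Pi_v(x)=0\ \forall v\in S_0\}$ and $W_0(S)=\{x\in W(S): x_\sigma\neq 0\ \forall \sigma\in S_2\}$. **Moves $f\colon S\to S'$ and induced maps $f_*\colon W_0(S)\to W(S')$.** In each case weights of 2-components not mentioned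 are unchanged. (i) Matveev--Piergallini move $2\to3$ (dual to the 2-3 Pachner move): two distinct true vertices joined by a triple edge, with pairs of opposite weights $(a,d),(b,y),(c,x)$ at one and $(a,d'),(b,y'),(c',x)$ at the other ($a,b,x$ being the sheets along the edge), are replaced by three true vertices spanning a new triangular 2-cell of weight $z$, with opposite pairs $(a,z),(c,y'),(c',y)$; $(b,z),(c,d'),(c',d)$; $(x,z),(d,y'),(d',y)$. The map $f_*$ keeps all old weights and sets $z=(cy'+c'y)/a$. For the inverse move $3\to2$, $f_*$ forgets $z$. (ii) Second Matveev--Piergallini (lune) move: inside a 3-ball, let $b$ be (the weight of) a 2-component, a piece of which is a strip in a horizontal plane between two disjoint arcs $\ell_1,\ell_2$ of triple lines. Along $\ell_1$ the other two sheets are one of weight $a$ continuing the plane beyond $\ell_1$ and one of weight $x$ attached from above; along $\ell_2$ the other two sheets are one of weight $c$ continuing the plane beyond $\ell_2$ and one of weight $y$ attached from below. (The arcs may lie on the same triple line and the 2-components may coincide.) The move pushes $\ell_1$ across $\ell_2$ in the plane, creating two true vertices and a new bigonal 2-cell of weight $z$, and cutting the component $b$ across the strip. At each new vertex the opposite pairs are $(a,c)$, $(x,y)$ and ($z$, the adjacent part of $b$). The map $f_*$ keeps all old weights (both parts of $b$ get weight $b$) and sets $z=(ac+xy)/b$. For the inverse move, $f_*$ forgets $z$; the two parts of $b$ have equal weights because $z\ne0$ and the two vertex relations hold. (iii) Bubble move: choose a closed disc $D$ in the interior of a 2-component of weight $a$ and glue to it another disc along $\partial D$. The result has two additional 2-components,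 of arbitrary weights $x,y$, and no new true vertices; the part of the original 2-component outside $D$ keeps weight $a$. Its induced map is the projection in the direction of bubble removal, $W(S')=W(S)\times K^2\to W(S)$, where $S'$ is the result of the bubble move on $S$. **The set $W_\infty$.** For $k\ge0$, $$W_{k+1}(S)=W_k(S)\cap\bigcap_{f\colon S\to S'}f_*^{-1}(W_k(S')),$$ the intersection being over all moves $f$ starting at $S$: the moves (i), (ii), their inverses, and bubble removals. Finally $W_\infty(S)=\bigcap_k W_k(S)$. *)

(* Defs.v *)
From mathcomp Require Import all_boot all_order all_algebra.
From mathcomp Require Import all_classical all_reals all_analysis.
Set Implicit Arguments.
Unset Strict Implicit.
Unset Printing Implicit Defensive.
Import Order.TTheory GRing.Theory Num.Theory numFieldNormedType.Exports.

Local Open Scope classical_set_scope.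
Local Open Scope ring_scope.

(** * Homeomorphisms between subsets *)

Definition homeo_onto (X Y : topologicalType) (A : set X) (f : X -> Y)
    (B : set Y) : Prop :=
  [/\ set_bij A B f, {within A, continuous f} &
      exists2 g : Y -> X, {in A, cancel f g} & {within B, continuous g}].

Definition homeomorphic (X Y : topologicalType) (A : set X) (B : set Y) : Prop :=
  exists f : X -> Y, homeo_onto A f B.

(** * Model sets in 3-space

    Points are triples (s, t, h); h is the height above the horizontal plane
    h = 0. *)

Definition cube (R : realType) (r : R) : set (R * R * R) :=
  [set q | [/\ `|q.1.1| < r, `|q.1.2| < r & `|q.2| < r]].

Definition closed_cube (R : realType) (r : R) : set (R * R * R) :=
  [set q | [/\ `|q.1.1| <= r, `|q.1.2| <= r & `|q.2| <= r]].

Definition half_cube (R : realType) (r : R) : set (R * R * R) :=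
  cube r `&` [set q | 0 <= q.2].

Definition disc_model (R : realType) : set (R * R * R) :=
  [set q | q.2 = 0].

(* Three half-planes meeting along the t-axis. *)
Definition triple_model (R : realType) : set (R * R * R) :=
  [set q | let: (s, t, h) := q in h = 0 \/ s = 0 /\ 0 <= h].

(* The four arcs are the half-axes of the plane h = 0.  The six sheets are the
   four quadrants of that plane, the upper half-plane of s = 0 (running along
   the two halves of the t-axis) and the lower half-plane of t = 0 (running
   along the two halves of the s-axis). *)
Definition butterfly_model (R : realType) : set (R * R * R) :=
  [set q | let: (s, t, h) := q in
     [\/ h = 0, s = 0 /\ 0 <= h | t = 0 /\ h <= 0]].

(* The locus where at least two of s, t, -(s+t) attain their maximum. *)
Definition tripod (R : realType) (s t : R) : Prop :=
  [\/ s = t /\ - (s + t) <= s,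
      t = - (s + t) /\ s <= t |
      s = - (s + t) /\ t <= s].

(* With m = max(s, t, -(s+t)), the two graphs h = H m and h = - H m, together
   with the part of the vertical walls over the tripod lying between them. *)
Definition mp_model (R : realType) (H : R -> R) : set (R * R * R) :=
  [set q | let: (s, t, h) := q in
     let m := Num.max (Num.max s t) (- (s + t)) in
     `|h| = H m \/ `|h| <= H m /\ tripod s t].

(* Two true vertices (0, 0, 1) and (0, 0, -1), joined by a vertical triple
   edge. *)
Definition mp_two (R : realType) : set (R * R * R) :=
  mp_model (fun m : R => m + 1).

(* Three true vertices, the corners of the triangle h = 0, m <= 1/3.  This
   agrees with [mp_two] where m >= 1. *)
Definition mp_three (R : realType) : set (R * R * R) :=
  mp_model (fun m : R => Num.max 0 (Num.min (m + 1) (3 * m - 1))).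

(* The plane h = 0, a wall s = u t h attached from above, and a wall s = 1
   attached from below. *)
Definition lune_model (R : realType) (u : R -> R -> R) : set (R * R * R) :=
  [set q | let: (s, t, h) := q in
     [\/ h = 0, 0 <= h /\ s = u t h | h <= 0 /\ s = 1]].

Definition lune_before (R : realType) : set (R * R * R) :=
  lune_model (fun _ _ : R => - 1).

(* The upper wall is pushed across the line s = 1 for |t| < 1/3; the new bigon
   is the part 1 <= s <= 2 - 3|t| of the plane. *)
Definition lune_after (R : realType) : set (R * R * R) :=
  lune_model (fun t h : R => Num.max (- 1) (2 - 3 * (`|t| + h))).

(* A plane with a pyramid-shaped disc glued along the boundary of a square. *)
Definition bubble_model (R : realType) : set (R * R * R) :=
  [set q | let: (s, t, h) := q in
     h = 0 \/ 0 <= h /\ h = 1 - Num.max `|s| `|t|].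

(** * 3-manifolds with boundary, realized as subsets of an ambient space *)

(* For N = [set: M] this is the usual manifold interior of M. *)
Definition manifold_interior (R : realType) (M : topologicalType) (N : set M) :
    set M :=
  [set p | exists (V : set M) (phi : R * R * R -> M),
     [/\ open V, phi (0, 0, 0) = p & homeo_onto (cube 1) phi (N `&` V)]].

Definition manifold_boundary (R : realType) (M : topologicalType) (N : set M) :
    set M :=
  N `\` manifold_interior R N.

Definition three_manifold (R : realType) (M : topologicalType) : Prop :=
  [/\ hausdorff_space M, @second_countable M &
      forall p : M, exists (V : set M) (phi : R * R * R -> M),
        [/\ open V, phi (0, 0, 0) = p &
            homeo_onto (cube 1) phi V \/ homeo_onto (half_cube 1) phi V]].

(** * Simple polyhedra embedded in M *)

Definition open_chart (R : realType) (M : topologicalType)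
    (D : set (R * R * R)) (phi : R * R * R -> M) : Prop :=
  open (phi @` D) /\ homeo_onto D phi (phi @` D).

Definition adapted_chart (R : realType) (M : topologicalType)
    (D X : set (R * R * R)) (S : set M) (phi : R * R * R -> M) : Prop :=
  open_chart D phi /\ forall q, D q -> (S (phi q) <-> X q).

Definition local_chart (R : realType) (M : topologicalType)
    (X : set (R * R * R)) (S : set M) (p : M) (phi : R * R * R -> M) : Prop :=
  adapted_chart (cube 1) X S phi /\ phi (0, 0, 0) = p.

Definition regular_points (R : realType) (M : topologicalType) (S : set M) :
    set M :=
  [set p | exists phi, local_chart (@disc_model R) S p phi].

Definition triple_points (R : realType) (M : topologicalType) (S : set M) :
    set M :=
  [set p | exists phi, local_chart (@triple_model R) S p phi].

Definition true_vertices (R : realType) (M : topologicalType) (S : set M) :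
    set M :=
  [set p | exists phi, local_chart (@butterfly_model R) S p phi].

(* Cells are modelled on the cube [-1, 1]^d. *)
Definition cell_open (R : realType) (d : nat) : set 'rV[R]_d :=
  [set v | forall j, `|v ord0 j| < 1].

Definition cell_closed (R : realType) (d : nat) : set 'rV[R]_d :=
  [set v | forall j, `|v ord0 j| <= 1].

(* For P in a Hausdorff space M; since there are finitely many cells, the
   remaining axioms of a CW-complex hold automatically. *)
Definition finite_CW (R : realType) (M : topologicalType) (P : set M) : Prop :=
  exists (n : nat) (d : 'I_n -> nat) (Phi : forall i, 'rV[R]_(d i) -> M),
    [/\ forall i, {within @cell_closed R (d i), continuous (Phi i)},
        forall i, set_inj (@cell_open R (d i)) (Phi i),
        trivIset setT (fun i => Phi i @` @cell_open R (d i)),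
        P = \bigcup_i (Phi i @` @cell_open R (d i)) &
        forall i, Phi i @` (@cell_closed R (d i) `\` @cell_open R (d i)) `<=`
          \bigcup_(j in [set j | (d j < d i)%N]) (Phi j @` @cell_open R (d j))].

Definition simple_polyhedron (R : realType) (M : topologicalType) (S : set M) :
    Prop :=
  finite_CW R S /\
  S `<=` regular_points R S `|` triple_points R S `|` true_vertices R S.

Definition two_components (R : realType) (M : topologicalType) (S : set M) :
    set (set M) :=
  [set connected_component (regular_points R S) p | p in regular_points R S].

Definition one_strata (R : realType) (M : topologicalType) (S : set M) :
    set (set M) :=
  [set connected_component (triple_points R S) p | p in triple_points R S].

Definition special (R : realType) (M : topologicalType) (S : set M) : Prop :=
  [/\ simple_polyhedron R S,
      forall l, one_strata R S l -> homeomorphic l [set: R] &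
      forall c, two_components R S c -> homeomorphic c [set: R * R]].

(** * Spines *)

Definition spine_of_bounded (R : realType) (M : topologicalType) (N S : set M) :
    Prop :=
  [/\ simple_polyhedron R S, S `<=` manifold_interior R N &
      homeomorphic (N `\` S) (manifold_boundary R N `*` `[(0 : R), 1[)].

(* The removed open ball has a collared boundary sphere: it is the unit cube of
   a chart defined on a larger cube. *)
Definition spine (R : realType) (M : topologicalType) (S : set M) : Prop :=
  (manifold_boundary R [set: M] !=set0 /\ spine_of_bounded R [set: M] S)
  \/
  (manifold_boundary R [set: M] = set0 /\
   exists phi : R * R * R -> M,
     open_chart (cube 2) phi /\ spine_of_bounded R (~` (phi @` cube 1)) S).

(** * Weights *)

Definition weights (R : realType) (K : fieldType) (M : topologicalType)
    (S : set M) : Type :=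
  two_components R S -> K.

(* The weight of the 2-component through p (0 if p is not a point of one). *)
Definition weight_at (R : realType) (K : fieldType) (M : topologicalType)
    (S : set M) (x : weights R K S) (p : M) : K :=
  oapp x 0 (insub (connected_component (regular_points R S) p)).

(* Each pair of opposite sheets of the butterfly is given by a pair of sample
   points. *)
Definition vertex_form (R : realType) (K : fieldType) (M : topologicalType)
    (S : set M) (phi : R * R * R -> M) (x : weights R K S) : K :=
  let w (s t h : R) := weight_at x (phi (s, t, h)) in
  let r : R := 2^-1 in
  w r r 0 * w (- r) (- r) 0 + w r (- r) 0 * w (- r) r 0 + w 0 0 r * w 0 0 (- r).

(* The form Pi_v does not depend on the chart at v. *)
Definition W (R : realType) (K : fieldType) (M : topologicalType) (S : set M) :
    set (weights R K S) :=
  [set x | forall v phi, local_chart (@butterfly_model R) S v phi ->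
     vertex_form phi x = 0].
Arguments W R K {M} S.

Definition W0 (R : realType) (K : fieldType) (M : topologicalType) (S : set M) :
    set (weights R K S) :=
  W R K S `&` [set x | forall sigma, x sigma != 0].
Arguments W0 R K {M} S.

(** * Moves and induced maps *)

Inductive move_kind : Type :=
  | MP23 | MP32 | LuneCreate | LuneRemove | BubbleRemove.

Definition model_before (R : realType) (k : move_kind) : set (R * R * R) :=
  match k with
  | MP23 => @mp_two R
  | MP32 => @mp_three R
  | LuneCreate => @lune_before R
  | LuneRemove => @lune_after R
  | BubbleRemove => @bubble_model R
  end.

Definition model_after (R : realType) (k : move_kind) : set (R * R * R) :=
  match k with
  | MP23 => @mp_three R
  | MP32 => @mp_two R
  | LuneCreate => @lune_after R
  | LuneRemove => @lune_before R
  | BubbleRemove => @disc_model R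
  end.

(* S is replaced by S' inside the ball move_map @` closed_cube 4.  The two
   models of each move agree outside closed_cube 3. *)
Record move (R : realType) (M : topologicalType) (S S' : set M) : Type := Move {
  move_type : move_kind;
  move_map : R * R * R -> M;
  move_before : adapted_chart (cube 5) (@model_before R move_type) S move_map;
  move_after : adapted_chart (cube 5) (@model_after R move_type) S' move_map;
  move_outside : forall p, ~ (move_map @` closed_cube 4) p -> (S p <-> S' p)
}.

Definition move_ball (R : realType) (M : topologicalType) (S S' : set M)
    (f : move R S S') : set M :=
  move_map f @` closed_cube 4.

(* A point of the 2-component created by the move, with the weight of that
   component.  In [mp_two] let N and S be the regions above and below the two
   graphs, and let A, B, C be the regions where s, t, -(s+t) respectively is
   maximal.  The sheets separating two regions carry the weights
     a = BC,  b = CA,  x = AB,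
     d = NA,  y = NB,  c = NC,  d' = SA,  y' = SB,  c' = SC,
   and the new triangle is NS. *)
Definition new_cell (R : realType) (K : fieldType) (M : topologicalType)
    (S S' : set M) (f : move R S S') (x : weights R K S) : option (M * K) :=
  let w (s t h : R) := weight_at x (move_map f (s, t, h)) in
  match move_type f with
  | MP23 =>
      let a := w (- 2) 1 0 in
      let c := w (- 1) (- 1) 3 in
      let c' := w (- 1) (- 1) (- 3) in
      let y := w 0 1 2 in
      let y' := w 0 1 (- 2) in
      Some (move_map f (0, 0, 0), (c * y' + c' * y) / a)
  | LuneCreate =>
      let a := w (- 2) 0 0 in
      let b := w 0 0 0 in
      let c := w 2 0 0 in
      let x := w (- 1) 0 1 in
      let y := w 1 0 (- 1) in
      Some (move_map f (3 / 2, 0, 0), (a * c + x * y) / b)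
  | MP32 | LuneRemove | BubbleRemove => None
  end.

(* Every 2-component of S' other than the new cell leaves the ball of the move,
   and outside that ball the regular points of S and S' are the same; the
   weight there is kept.  For [LuneRemove] this does not depend on the chosen
   point when x is in [W0 S]. *)
Definition kept_weight (R : realType) (K : fieldType) (M : topologicalType)
    (S S' : set M) (f : move R S S') (x : weights R K S) : weights R K S' :=
  fun sigma => weight_at x
    (xget (move_map f (0, 0, 0)) (val sigma `\` move_ball f)).

Definition induced (R : realType) (K : fieldType) (M : topologicalType)
    (S S' : set M) (f : move R S S') (x : weights R K S) : weights R K S' :=
  fun sigma =>
    if new_cell f x is Some (p, z) then
      if `[< val sigma p >] then z else kept_weight f x sigma
    else kept_weight f x sigma.

Fixpoint Wn (R : realType) (K : fieldType) (M : topologicalType) (k : nat)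
    {struct k} : forall S : set M, set (weights R K S) :=
  match k with
  | 0%N => fun S => W0 R K S
  | k'.+1 => fun S =>
      @Wn R K M k' S `&`
      [set x | forall (S' : set M) (f : move R S S'),
         (induced f @^-1` @Wn R K M k' S') x]
  end.

Definition Winfty (R : realType) (K : fieldType) (M : topologicalType)
    (S : set M) : set (weights R K S) :=
  \bigcap_k @Wn R K M k S.
Arguments Winfty R K {M} S.

(* Main.v *)
(** Next to a triple line, let b be one of the three sheets and p, q the other
    two.  A lune move may be performed along a strip of b whose two ends lie on
    this same triple line.  Relative to the normal direction of b, the sheets at
    one end are p above and q below, and the same holds at the other end; since
    the move pairs an upper sheet at one end with a lower sheet at the other,
    the new weight is (p q + p q) / b, which is 0 in characteristic 2.  So
    already W_1 is empty as soon as there is a triple line.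

    There is one: a special spine is nonempty and compact, and without triple
    lines each of its 2-components would be closed in it, hence a compact plane. *)

Require Import Defs.
From mathcomp Require Import all_boot all_order all_algebra.
From mathcomp Require Import all_classical all_reals all_analysis.
From mathcomp Require Import lra ring.
Import Order.TTheory GRing.Theory Num.Theory.
Import numFieldNormedType.Exports.
Local Open Scope classical_set_scope.
Local Open Scope ring_scope.

Set Implicit Arguments.
Unset Strict Implicit.

(** * Charts and their reparametrization *)

Lemma continuous_coordinates (R : realType) :
  [/\ continuous (fun q : R * R * R => q.1.1),
      continuous (fun q : R * R * R => q.1.2) &
      continuous (fun q : R * R * R => q.2)].
Proof.
split=> q.
- by apply: (@continuous_comp _ _ _ fst fst); exact: cvg_fst.
- by apply: (@continuous_comp _ _ _ fst snd); [exact: cvg_fst|exact: cvg_snd].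
- exact: cvg_snd.
Qed.

Lemma continuous_triple (R : realType) (T : topologicalType) (f g h : T -> R)
    (p : T) :
  {for p, continuous f} -> {for p, continuous g} -> {for p, continuous h} ->
  {for p, continuous (fun q => (f q, g q, h q))}.
Proof.
by move=> cf cg ch; exact: (cvg_pair (cvg_pair cf cg) ch).
Qed.

Lemma open_cube (R : realType) (r : R) : open (cube r).
Proof.
have [c1 c2 c3] := continuous_coordinates R.
have op (f : R * R * R -> R) : continuous f -> open [set q | `|f q| < r].
  move=> cf; have -> : [set q | `|f q| < r] =
      (fun q => `|f q|) @^-1` [set y | y < r] by [].
  apply: (@open_comp _ _ (fun q => `|f q|) [set y | y < r]); last exact: open_lt.
  by move=> q _; apply: continuous_comp; [exact: cf|exact: norm_continuous].
have -> : cube r = [set q : R * R * R | `|q.1.1| < r] `&`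
    [set q : R * R * R | `|q.1.2| < r] `&` [set q : R * R * R | `|q.2| < r].
  by apply/seteqP; split=> q [] => [|[]].
by apply: openI; [apply: openI|]; [exact: op c1|exact: op c2|exact: op c3].
Qed.

Lemma open_chart_inverse (R : realType) (M : topologicalType)
    (D : set (R * R * R)) (phi : R * R * R -> M) :
  open_chart D phi -> exists2 psi : M -> R * R * R,
    (forall q, D q -> psi (phi q) = q) & {in phi @` D, continuous psi}.
Proof.
move=> [oB [_ _ [psi psiK cpsi]]]; exists psi.
  by move=> q Dq; apply: psiK; rewrite inE.
by rewrite -continuous_open_subspace.
Qed.

Lemma open_chart_comp (R : realType) (M : topologicalType)
    (D E V : set (R * R * R)) (phi : R * R * R -> M)
    (f g : R * R * R -> R * R * R) :
  open D -> open E -> open V -> open_chart D phi ->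
  {in E, continuous f} -> {in V, continuous g} ->
  (forall q, E q -> [/\ D (f q), V (f q) & g (f q) = q]) ->
  (forall r, V r -> f (g r) = r) ->
  open_chart E (phi \o f).
Proof.
move=> oD oE oV chart cf cg fE gV.
have [psi psiK cpsi] := open_chart_inverse chart.
case: chart => oB [_ cphi _].
have imE : (phi \o f) @` E =
    (phi @` D) `&` psi @^-1` (V `&` g @^-1` E).
  apply/seteqP; split=> p.
    move=> [q Eq <-]; have [Dq Vq gq] := fE _ Eq.
    by split; [exists (f q)|rewrite /= psiK//; split=> //=; rewrite gq].
  move=> [[r Dr <-]] /=; rewrite psiK// => -[Vr Egr].
  by exists (g r) => //=; rewrite gV.
have oI : open ((phi \o f) @` E).
  rewrite imE; move/continuous_inP: cpsi; apply => //.
  by move/continuous_inP: cg; apply.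
split=> //; split.
- split=> [q Eq|q q' /set_mem Eq /set_mem Eq' /= eqf|//].
    by exists q.
  have [Dq _ gq] := fE _ Eq; have [Dq' _ gq'] := fE _ Eq'.
  by rewrite -gq -(psiK _ Dq) eqf psiK.
- rewrite continuous_open_subspace// => q Eq; apply: continuous_comp.
    exact: cf.
  rewrite continuous_open_subspace// in cphi.
  by apply: cphi; rewrite inE; have [] := fE _ (set_mem Eq).
- exists (g \o psi).
    by move=> q /set_mem Eq /=; have [Dq _ gq] := fE _ Eq; rewrite psiK.
  rewrite continuous_open_subspace// => p /set_mem [q Eq <-] /=.
  have [Dq Vq gq] := fE _ Eq; apply: continuous_comp.
    by apply: cpsi; rewrite inE; exists (f q).
  by rewrite psiK//; apply: cg; rewrite inE.
Qed.

Definition dilate (R : realType) (c : R * R * R) (r : R) (q : R * R * R) :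
    R * R * R :=
  (c.1.1 + r * q.1.1, c.1.2 + r * q.1.2, c.2 + r * q.2).

Lemma dilate_continuous (R : realType) (c : R * R * R) (r : R) :
  continuous (dilate c r).
Proof.
have [c1 c2 c3] := continuous_coordinates R.
have cvg_aff (a : R) (f : R * R * R -> R) :
    continuous f -> continuous (fun q => a + r * f q).
  move=> cf q; apply: cvgD; first exact: cvg_cst.
  by apply: cvgM; [exact: cvg_cst|exact: cf].
by move=> q; exact: (continuous_triple (cvg_aff _ _ c1 q) (cvg_aff _ _ c2 q)
  (cvg_aff _ _ c3 q)).
Qed.

(** Zooming in at [c] until only the local shape [Y] of the model [X] is visible; this is how points
    near the centre of a chart are recognized as regular or triple points. *)
Lemma local_chart_dilate (R : realType) (M : topologicalType)
    (D X Y : set (R * R * R)) (S : set M) (phi : R * R * R -> M)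
    (c : R * R * R) (r : R) :
  open D -> 0 < r -> adapted_chart D X S phi ->
  (forall q, cube 1 q -> D (dilate c r q) /\ (X (dilate c r q) <-> Y q)) ->
  local_chart Y S (phi c) (phi \o dilate c r).
Proof.
move=> oD r0 [chart SX] XY.
have rn : r != 0 by rewrite gt_eqF.
split; last by case: c {XY} => -[s t] h /=; rewrite /dilate /= !mulr0 !addr0.
split; last first.
  move=> q q1; have [Dq <-] := XY _ q1; exact: SX.
apply: (@open_chart_comp _ _ D (cube 1) setT _ _
  (fun q => dilate (0, 0, 0) r^-1 (dilate (- c) 1 q))) => //.
- exact: open_cube.
- exact: openT.
- by move=> q _; exact: dilate_continuous.
- move=> q _; apply: (@continuous_comp _ _ _ (dilate (- c) 1));
  exact: dilate_continuous.
- move=> q q1; have [Dq _] := XY _ q1; split=> //.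
  case: q {q1 Dq} => -[s t] h; case: c {XY} => -[a b] d.
  by rewrite /dilate /=; congr (_, _, _); field.
- move=> q _.
  case: q => -[s t] h; case: c {XY} => -[a b] d.
  by rewrite /dilate /=; congr (_, _, _); field.
Qed.

(** * Placing the neighbourhood of a lune move around a triple line *)

(* Vanishes on [-1, 1] and has slope 1 elsewhere. *)
Definition excess (R : realType) (s : R) : R := s - (`|s + 1| - `|s - 1|) / 2.

(* Bending the plane h = 0 up along s > 1 and down along s < -1, so that each
   slice at height H <> 0 meets [lune_before] in two lines. *)
Definition fold_height (R : realType) (q : R * R * R) : R := q.2 + excess q.1.1.

(* The two lines of a slice are those where |2 s - H| = 2 + |H|.  In the plane
   coordinates of the last two components the strip between them is folded onto
   a half-plane: a pair of lines issuing from a common (missing) point becomes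
   one line, tau > 0 being the radial coordinate.  The sheet H = 0 of
   [lune_before] goes to the upper half-plane of s = 0 in [triple_model]. *)
Definition fold_lune (R : realType) (c : R) (q : R * R * R) : R * R * R :=
  let H := fold_height q in
  let tau := q.1.2 + 6 in
  (H / c, tau * (2 * q.1.1 - H) / c,
   tau * (2 + `|H| - `|2 * q.1.1 - H|) / c).

(** Inverse of [fold_lune]. With B = 2 s - H, the last two coordinates X = tau B / c and Y = tau (2
    + |H| - |B|) / c satisfy Y + |X| = tau (2 + |H|) / c. This recovers tau, then B = c X / tau, and
    finally s. *)
Definition unfold_lune (R : realType) (c : R) (r : R * R * R) : R * R * R :=
  let H := c * r.1.1 in
  let tau := c * (r.2 + `|r.1.2|) / (2 + `|H|) in
  let s := (c * r.1.2 / tau + H) / 2 in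
  (s, tau - 6, H - excess s).

(** For c > 0, the locus where the recovered tau is positive, so that the division by tau in
    [unfold_lune] is harmless. *)
Definition fold_range (R : realType) : set (R * R * R) := [set r | 0 < r.2 + `|r.1.2|].

Lemma excess_continuous (R : realType) : continuous (@excess R).
Proof.
have cn (a : R) : continuous (fun s : R => `|s + a|).
  move=> s; apply: (@continuous_comp _ _ _ (fun s => s + a) Num.norm).
    by apply: cvgD; [exact: cvg_id|exact: cvg_cst].
  exact: norm_continuous.
move=> s; apply: cvgB; first exact: cvg_id.
apply: cvgM; last exact: cvg_cst.
by apply: cvgB; apply: cn.
Qed.

Lemma fold_lune_continuous (R : realType) (c : R) : continuous (fold_lune c).
Proof.
have [c1 c2 c3] := continuous_coordinates R.
have cH : continuous (@fold_height R).
  move=> q; apply: cvgD; first exact: c3.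
  by apply: (@continuous_comp _ _ _ (fun q : R * R * R => q.1.1) (@excess R));
    [exact: c1|exact: excess_continuous].
have cs : continuous (fun q : R * R * R => 2 * q.1.1 - fold_height q).
  move=> q; apply: cvgB; last exact: cH.
  by apply: cvgM; [exact: cvg_cst|exact: c1].
have ctau : continuous (fun q : R * R * R => q.1.2 + 6).
  by move=> q; apply: cvgD; [exact: c2|exact: cvg_cst].
have cn (f : R * R * R -> R) : continuous f -> continuous (fun q => `|f q|).
  by move=> cf q; apply: continuous_comp; [exact: cf|exact: norm_continuous].
have cscale (f : R * R * R -> R) : continuous f ->
    continuous (fun q => f q / c).
  by move=> cf q; apply: cvgM; [exact: cf|exact: cvg_cst].
move=> q; apply: (continuous_triple (cscale _ cH q)
  (cscale (fun q : R * R * R => (q.1.2 + 6) * (2 * q.1.1 - fold_height q)) _ q)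
  (cscale (fun q : R * R * R => (q.1.2 + 6) *
    (2 + `|fold_height q| - `|2 * q.1.1 - fold_height q|)) _ q)).
- by move=> p; apply: cvgM; [exact: ctau|exact: cs].
- move=> p; apply: cvgM; first exact: ctau.
  apply: cvgB; last exact: cn.
  by apply: cvgD; [exact: cvg_cst|exact: cn].
Qed.

Lemma unfold_lune_continuous (R : realType) (c : R) : 0 < c ->
  {in @fold_range R, continuous (unfold_lune c)}.
Proof.
move=> c0; have [c1 c2 c3] := continuous_coordinates R.
have cn (f : R * R * R -> R) : continuous f -> continuous (fun q => `|f q|).
  by move=> cf q; apply: continuous_comp; [exact: cf|exact: norm_continuous].
have cH : continuous (fun r : R * R * R => c * r.1.1).
  by move=> r; apply: cvgM; [exact: cvg_cst|exact: c1].
have pos (x : R) : 0 < 2 + `|x| by have := normr_ge0 x; lra.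
pose tau (r : R * R * R) := c * (r.2 + `|r.1.2|) / (2 + `|c * r.1.1|).
have ctau : continuous tau.
  move=> r; apply: cvgM.
    apply: cvgM; first exact: cvg_cst.
    by apply: cvgD; [exact: c3|exact: cn].
  apply: cvgV; first by rewrite gt_eqF.
  by apply: cvgD; [exact: cvg_cst|exact: cn].
pose s (r : R * R * R) := (c * r.1.2 / tau r + c * r.1.1) / 2.
move=> r /set_mem Vr.
have cs : {for r, continuous s}.
  apply: cvgM; last exact: cvg_cst.
  apply: cvgD; last exact: cH.
  apply: cvgM; first by apply: cvgM; [exact: cvg_cst|exact: c2].
  apply: cvgV; last exact: ctau.
  have tau0 : 0 < tau r.
    by apply: divr_gt0; [apply: mulr_gt0; [exact: c0|exact: Vr]|exact: pos].
  by apply: lt0r_neq0.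
apply: (continuous_triple cs (g := fun r => tau r - 6)
  (h := fun r => c * r.1.1 - excess (s r))).
  by apply: cvgB; [exact: ctau|exact: cvg_cst].
apply: cvgB; first exact: cH.
apply: continuous_comp; first exact: cs.
exact: excess_continuous.
Qed.

Lemma open_fold_range (R : realType) : open (@fold_range R).
Proof.
have [c1 c2 c3] := continuous_coordinates R.
have -> : @fold_range R = (fun r => r.2 + `|r.1.2|) @^-1` [set x : R | 0 < x] by [].
apply: open_comp; last exact: open_gt.
move=> r _; apply: cvgD; first exact: c3.
apply: (@continuous_comp _ _ _ (fun r : R * R * R => r.1.2) Num.norm).
  exact: c2.
exact: norm_continuous.
Qed.

Lemma fold_luneK (R : realType) (c : R) (q : R * R * R) : 0 < c ->
  0 < q.1.2 + 6 ->
  fold_range (fold_lune c q) /\ unfold_lune c (fold_lune c q) = q.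
Proof.
move=> c0 tau0; rewrite /fold_range /unfold_lune /=.
set H := fold_height q; set tau := q.1.2 + 6; rewrite -/tau in tau0.
have Hc : c * (H / c) = H by field; rewrite ?gt_eqF.
have D0 : 0 < 2 + `|H| by have := normr_ge0 H; lra.
have sumE : tau * (2 + `|H| - `|2 * q.1.1 - H|) / c +
    `|tau * (2 * q.1.1 - H) / c| = tau * (2 + `|H|) / c.
  rewrite !normrM (gtr0_norm tau0) (@gtr0_norm _ (c^-1)) ?invr_gt0//.
  by field; rewrite gt_eqF.
rewrite sumE Hc.
have tauE : c * (tau * (2 + `|H|) / c) / (2 + `|H|) = tau.
  by field; rewrite ?gt_eqF.
rewrite tauE.
have sE : (c * (tau * (2 * q.1.1 - H) / c) / tau + H) / 2 = q.1.1.
  by field; rewrite ?gt_eqF.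
rewrite sE; split.
  by rewrite !mulr_gt0// invr_gt0.
case: q @H @tau {tau0 Hc D0 sumE tauE sE} => -[s t] h /=.
by rewrite /fold_height /=; congr (_, _, _); ring.
Qed.

Lemma unfold_luneK (R : realType) (c : R) (r : R * R * R) : 0 < c ->
  fold_range r -> fold_lune c (unfold_lune c r) = r.
Proof.
move=> c0.
rewrite /fold_range /= => u0; rewrite /fold_lune /fold_height /unfold_lune /=.
set H := c * r.1.1; set tau := c * (r.2 + `|r.1.2|) / (2 + `|H|).
have D0 : 0 < 2 + `|H| by have := normr_ge0 H; lra.
have tau0 : 0 < tau by rewrite /tau divr_gt0// mulr_gt0.
set s := _ / 2; rewrite !subrK.
have sE : 2 * s - H = c * r.1.2 / tau by rewrite /s; field; rewrite gt_eqF.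
rewrite sE.
have bE : tau * (c * r.1.2 / tau) = c * r.1.2 by field; rewrite ?gt_eqF.
rewrite mulrBr.
have -> : tau * `|c * r.1.2 / tau| = c * `|r.1.2|.
  rewrite -[X in X * _](gtr0_norm tau0) -normrM bE normrM.
  by rewrite (gtr0_norm c0).
rewrite bE /tau divfK ?gt_eqF//.
rewrite /H; case: r {u0 H tau D0 tau0 s sE bE} => -[a b] d /=.
by congr (_, _, _); field; rewrite ?gt_eqF.
Qed.

(** On [cube 5] one has 1 < tau < 11, |H| < 9 and hence |2 s - H| < 10 + 9 = 19; the bound on [c] is
    11 * 19 = 209. *)
Lemma fold_lune_cube (R : realType) (c : R) (q : R * R * R) : 209 < c ->
  cube 5 q -> cube 1 (fold_lune c q).
Proof.
move=> c209; have c0 : 0 < c by lra.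
case: q => -[s t] h [/= hs ht hh].
move: hs ht hh; rewrite !ltr_norml => /andP[s1 s2] /andP[t1 t2] /andP[h1 h2].
rewrite /fold_lune /fold_height /excess /=.
set n1 := `|s + 1|; set n2 := `|s - 1|.
have Hb : `|h + (s - (n1 - n2) / 2)| < 9.
  rewrite ltr_norml /n1 /n2.
  by case: (ger0P (s + 1)); case: (ger0P (s - 1)) => ? ?; lra.
set H := h + _ in Hb *.
have Bb : `|2 * s - H| < 19.
  by move: Hb; rewrite !ltr_norml => /andP[? ?]; lra.
have D0 := normr_ge0 H; have B0 := normr_ge0 (2 * s - H).
have cut (x : R) : `|x| < 19 -> `|(t + 6) * x / c| < 1.
  move=> hx; rewrite !normrM (@gtr0_norm _ (t + 6)); last by lra.
  rewrite (@gtr0_norm _ (c^-1)) ?invr_gt0// ltr_pdivrMr// mul1r.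
  have := normr_ge0 x => x0.
  have : (t + 6) * `|x| <= 11 * 19 by apply: ler_pM; lra.
  by lra.
split=> /=.
- rewrite normrM (@gtr0_norm _ c^-1) ?invr_gt0// ltr_pdivrMr// mul1r.
  by lra.
- exact: cut.
- by apply: cut; rewrite ltr_norml; lra.
Qed.

Lemma fold_lune_model (R : realType) (c : R) (q : R * R * R) : 0 < c ->
  cube 5 q -> triple_model (fold_lune c q) <-> lune_before q.
Proof.
move=> c0.
case: q => -[s t] h [/= _ ht _].
have tau0 : 0 < t + 6 by move: ht; rewrite ltr_norml => /andP[? ?]; lra.
rewrite /fold_lune /fold_height /excess /triple_model /lune_before /lune_model /=.
set H := h + _.
have K0 (x : R) : (x / c = 0) <-> x = 0.
  split=> [/eqP|->]; last by rewrite mul0r.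
  by rewrite mulf_eq0 invr_eq0 (gt_eqF c0) orbF => /eqP.
have H0 := K0 H.
set A := 2 + `|H| - `|2 * s - H|.
have A0 : ((t + 6) * A / c = 0) <-> A = 0.
  rewrite K0; split=> [/eqP|->]; last by rewrite mulr0.
  by rewrite mulf_eq0 (gt_eqF tau0) => /eqP.
have A1 : (0 <= (t + 6) * A / c) = (0 <= A).
  by rewrite pmulr_lge0 ?invr_gt0// pmulr_rge0.
rewrite A0 H0 A1 /A {A A0 A1 H0}.
(* The positive factors tau and 1 / c are gone. Once the signs inside the four absolute values are
   fixed, both models are given by linear conditions. *)
case: (ger0P H) => H1; case: (ger0P (2 * s - H)) => H2;
  rewrite /H {H} in H1 H2 *; move: H1 H2;
  (case: (ger0P (s + 1)) => s1; case: (ger0P (s - 1)) => s2) => H1 H2; split;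
  by [move=> [?|[? ?]]; [> (constructor 1; lra) || (constructor 2; split; lra) ||
        (constructor 3; split; lra) ..]
     |move=> [?|[? ?]|[? ?]]; [> (left; lra) || (right; split; lra) ..]].
Qed.

(** * Performing the move *)

(** Provides the target of a move: [S] is kept off the chart and replaced by the model [Y] inside
    it. As the models agree off [E], nothing changes outside the image of [E]. *)
Lemma replace_in_chart (R : realType) (M : topologicalType)
    (D E X Y : set (R * R * R)) (S : set M) (phi : R * R * R -> M) :
  adapted_chart D X S phi ->
  (forall q, D q -> ~ E q -> (X q <-> Y q)) ->
  exists S' : set M, adapted_chart D Y S' phi /\
    forall p, ~ (phi @` E) p -> (S p <-> S' p).
Proof.
move=> [chart SX] XY.
have phi_inj q q' : D q -> D q' -> phi q = phi q' -> q = q'.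
  case: chart => _ [[_ inj _] _ _] Dq Dq'.
  by apply: inj; rewrite inE.
exists [set p | (S p /\ ~ (phi @` D) p) \/ (phi @` (D `&` Y)) p]; split.
  split=> // q Dq; split=> [[[_ []]|[q' [Dq' Yq'] eqq]]|Yq].
  - by exists q.
  - by rewrite -(phi_inj _ _ Dq' Dq eqq).
  - by right; exists q.
move=> p Ep; split=> [Sp|[[]//|[q [Dq Yq] qp]]].
  have [[q Dq qp]|] := pselect ((phi @` D) p); last by left.
  right; exists q => //; split=> //; apply/(XY q Dq).
    by move=> Eq; apply: Ep; exists q.
  by apply/(SX q Dq); rewrite qp.
rewrite -qp; apply/SX => //; apply/XY => // Eq.
by apply: Ep; exists q.
Qed.

(** The upper walls can differ only where |t| + h <= 1; there both have -1 <= s <= 2, so they stay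
    inside the closed cube. *)
Lemma lune_models_agree (R : realType) (q : R * R * R) :
  ~ closed_cube 4 q -> lune_before q <-> lune_after q.
Proof.
case: q => -[s t] h out.
suff : 0 <= h -> s = Num.max (- 1) (2 - 3 * (`|t| + h)) <-> s = - 1.
  move=> wall; rewrite /lune_before /lune_after /lune_model /=.
  by split=> -[?|[h0 ?]|?];
    [constructor 1|constructor 2; split=> //; apply/wall|constructor 3|
     constructor 1|constructor 2; split=> //; apply/wall|constructor 3].
move=> h0; case: (lerP (- 1) (2 - 3 * (`|t| + h))) => near; last by [].
have t0 := normr_ge0 t.
by split=> sE; case: out; split; rewrite /= ?(ger0_norm h0);
  try lra; rewrite ler_norml; lra.
Qed.

(** * Weights of the sheets and of the new bigon *)

(** The segment parallel to the triple line consists of regular points. It will join the samples of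
    one sheet taken at the two ends of the strip. *)
Lemma triple_sheet_component (R : realType) (M : topologicalType) (S : set M)
    (psi : R * R * R -> M) (a b b' : R) :
  adapted_chart (cube 1) (@triple_model R) S psi ->
  a != 0 -> `|a| < 1 -> `|b| < 1 -> `|b'| < 1 -> b <= b' ->
  connected_component (regular_points R S) (psi (a, b, 0)) =
  connected_component (regular_points R S) (psi (a, b', 0)).
Proof.
move=> chart a0 a1 b1 b1' bb'.
have cube_seg t : `[b, b']%classic t -> cube 1 (a, t, 0 : R).
  rewrite /= in_itv /= => /andP[bt tb']; split; rewrite /= ?normr0//.
  by move: b1 b1'; rewrite !ltr_norml => /andP[? ?] /andP[? ?]; lra.
have cpsi : {in cube 1, continuous psi}.
  case: chart => -[_ [_ cpsi _]] _.
  by rewrite continuous_open_subspace in cpsi; last exact: open_cube.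
apply: same_connected_component.
apply: (@connected_component_max _ _
  ((fun t : R => psi (a, t, 0)) @` `[b, b']%classic)).
- by exists b => //=; rewrite in_itv /= lexx.
- move=> _ [t /cube_seg [/= _ t1 _] <-].
  (* [r] is at most the distance to the wall s = 0 and to the faces of the unit cube. Half of it
     leaves the small cube clear of both, so only the plane h = 0 is seen. *)
  have [r r0 [ra ra1 rt]] : exists2 r : R, 0 < r &
      [/\ r <= `|a|, r <= 1 - `|a| & r <= 1 - `|t|].
    exists (Num.min `|a| (Num.min (1 - `|a|) (1 - `|t|))).
      by rewrite !lt_min normr_gt0 a0 !subr_gt0 a1.
    by rewrite !ge_min !lexx !orbT.
  exists (psi \o dilate (a, t, 0) (r / 2)).
  apply: (local_chart_dilate _ _ chart); first exact: open_cube.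
    by rewrite divr_gt0.
  case=> -[s' t'] h' [/= s1 t1' h1].
  have small (x : R) : `|x| < 1 -> `|r / 2 * x| <= r / 2.
    move=> x1; rewrite normrM (@ger0_norm _ (r / 2)); last lra.
    by rewrite ler_piMr ?(ltW x1)//; lra.
  have := small _ s1; have := small _ t1'; have := small _ h1.
  rewrite /dilate /= !ler_norml.
  move=> /andP[h2 h3] /andP[t2 t3] /andP[s2 s3].
  split.
    split; rewrite /= ltr_norml; move: a1 t1 rt ra ra1; rewrite ?ltr_norml;
    case: (ger0P a); case: (ger0P t); lra.
  rewrite /triple_model /disc_model /= add0r.
  have -> : (r / 2 * h' = 0) <-> h' = 0.
    split=> [/eqP|->]; last by rewrite mulr0.
    by rewrite mulf_eq0 gt_eqF ?divr_gt0//= => /eqP.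
  split=> [[//|[]]|]; last by left.
  by move: a0 ra; rewrite neq_lt; case: (ger0P a) => ? /orP[] ?; lra.
- apply: connected_continuous_connected; first exact: segment_connected.
  apply: continuous_in_subspaceT => t /set_mem bt.
  apply: (@continuous_comp _ _ _ (fun t : R => (a, t, 0))).
    by apply: (@continuous_triple _ _ (fun=> a) id (fun=> 0));
      [exact: cvg_cst|exact: cvg_id|exact: cvg_cst].
  by apply: cpsi; rewrite inE; exact: cube_seg.
- by exists b' => //=; rewrite in_itv /= bb' lexx.
Qed.

(* The samples of the sheets [a], [c], [x], [y] of the lune move. *)
Lemma fold_lune_samples (R : realType) (c : R) :
  [/\ fold_lune c (- 2, 0, 0) = (- c^-1, - 18 / c, 0),
      fold_lune c (2, 0, 0) = (c^-1, 18 / c, 0),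
      fold_lune c (- 1, 0, 1) = (c^-1, - 18 / c, 0) &
      fold_lune c (1, 0, - 1) = (- c^-1, 18 / c, 0)].
Proof.
have foldE (s h H B : R) : fold_height (s, 0, h) = H ->
    2 * s - H = B -> 2 + `|H| - `|B| = 0 ->
    fold_lune c (s, 0, h) = (H / c, 6 * B / c, 0).
  by rewrite /fold_lune => -> /= -> ->; rewrite add0r mulr0 mul0r.
have excessE (s d e : R) : `|s + 1| = d -> `|s - 1| = e ->
    excess s = s - (d - e) / 2 by rewrite /excess => -> ->.
split.
- rewrite (foldE _ _ (- 1) (- 3)); [by congr (_, _, _); lra| |lra|].
    by rewrite /fold_height /= (excessE _ 1 3) ?ler0_norm; lra.
  by rewrite !ler0_norm; lra.
- rewrite (foldE _ _ 1 3); [by congr (_, _, _); lra| |lra|].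
    by rewrite /fold_height /= (excessE _ 3 1) ?ger0_norm; lra.
  by rewrite !ger0_norm; lra.
- rewrite (foldE _ _ 1 (- 3)); [by congr (_, _, _); lra| |lra|].
    by rewrite /fold_height /= (excessE _ 0 2) ?addNr ?normr0 ?ler0_norm; lra.
  by rewrite ger0_norm ?ler0_norm; lra.
- rewrite (foldE _ _ (- 1) 3); [by congr (_, _, _); lra| |lra|].
    by rewrite /fold_height /= (excessE _ 2 0) ?subrr ?normr0 ?ger0_norm; lra.
  by rewrite ler0_norm ?ger0_norm; lra.
Qed.

(** Within 1/24 of (3/2, 0, 0) the upper wall would need s > 7/4 and the lower one s = 1, while |s -
    3/2| < 1/24; only the plane remains. *)
Lemma lune_after_bigon (R : realType) (M : topologicalType) (S : set M)
    (phi : R * R * R -> M) :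
  adapted_chart (cube 5) (@lune_after R) S phi ->
  regular_points R S (phi (3 / 2, 0, 0)).
Proof.
move=> chart; exists (phi \o dilate (3 / 2, 0, 0) (1 / 24)).
apply: (local_chart_dilate _ _ chart); [exact: open_cube|lra|].
case=> -[s t] h [/= s1 t1 h1].
have t24 : `|0 + 1 / 24 * t| = `|t| / 24.
  by rewrite add0r normrM ger0_norm; lra.
move: s1 h1; rewrite /dilate !ltr_norml => /andP[? ?] /andP[? ?].
split.
  split=> /=; [|rewrite t24|]; rewrite ?ltr_norml; lra.
rewrite /lune_after /lune_model /disc_model /= t24.
have far : 3 / 2 + 1 / 24 * s < 2 - 3 * (`|t| / 24 + (0 + 1 / 24 * h)) by lra.
split=> [[?|[_ sE]|[_ ?]]|->]; [lra| |lra|by constructor 1; lra].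
by move: far; rewrite sE gt_max ltxx andbF.
Qed.

Lemma triple_line_Winfty (R : realType) (K : closedFieldType)
    (M : topologicalType) (S : set M) (psi : R * R * R -> M)
    (x : weights R K S) :
  2%N \in [pchar K] -> adapted_chart (cube 1) (@triple_model R) S psi ->
  ~ Winfty R K S x.
Proof.
move=> char2 chart Wx; pose c : R := 210.
have c0 : 0 < c by rewrite /c; lra.
pose phi := psi \o fold_lune c.
have before : adapted_chart (cube 5) (@lune_before R) S phi.
  have cube1 q : cube 5 q -> cube 1 (fold_lune c q).
    by apply: fold_lune_cube; rewrite /c; lra.
  case: chart => chart SX; split; last first.
    by move=> q q5; rewrite -(fold_lune_model c0 q5); apply: SX; exact: cube1.
  apply: (@open_chart_comp _ _ (cube 1) _ (@fold_range R) _ _ (unfold_lune c)).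
  - exact: open_cube.
  - exact: open_cube.
  - exact: open_fold_range.
  - exact: chart.
  - by move=> q _; exact: fold_lune_continuous.
  - exact: unfold_lune_continuous.
  - move=> q q5; have [] := @fold_luneK _ c q c0; last by split=> //; exact: cube1.
    by case: q5 => _ + _; rewrite ltr_norml => /andP[? ?]; lra.
  - by move=> r; exact: unfold_luneK.
have [S' [after outside]] := replace_in_chart before
  (fun q _ => @lune_models_agree _ q).
pose f := @Move R M S S' LuneCreate phi before after outside.
have bigon := lune_after_bigon after.
pose sigma0 := connected_component (regular_points R S') (phi (3 / 2, 0, 0)).
have sigma_mem : sigma0 \in two_components R S'.
  by rewrite inE; exists (phi (3 / 2, 0, 0)).
pose sigma : two_components R S' := SigSub sigma_mem.
(* Membership in W_1 makes the induced weight of the bigon nonzero. Since [sigma] contains the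
   sample point of the new cell, [induced] returns there the weight given by the lune formula. *)
have [_ /(_ S' f) [_ /(_ sigma)]] := Wx 1%N I.
rewrite /Defs.induced /= /phi /= (asboolT (connected_component_refl bigon : sigma0 _)).
have [-> -> -> ->] := fold_lune_samples c.
(* In [triple_model] the samples of the sheets a and y lie on the side s < 0 of the plane, those of
   c and x on the side s > 0. Sliding along the triple line gives a = y and c = x, so a c + x y
   becomes a c + c a. *)
have wE (a : R) : a = c^-1 \/ a = - c^-1 ->
    weight_at x (psi (a, - 18 / c, 0)) = weight_at x (psi (a, 18 / c, 0)).
  move=> ac; rewrite /weight_at (triple_sheet_component chart (b' := 18 / c))//.
  - by case: ac => ->; rewrite ?oppr_eq0 invr_eq0 gt_eqF.
  - by rewrite ltr_norml; case: ac => ->; rewrite /c; lra.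
  - by rewrite ltr_norml /c; lra.
  - by rewrite ltr_norml /c; lra.
  - by rewrite /c; lra.
rewrite !wE; [|by left|by right].
by rewrite [X in _ + X]mulrC addrr_pchar2// mul0r eqxx.
Qed.

(** * Existence of a triple line *)

(** Within 1/4 of (0, 1/2, 0) the lower sheet t = 0 of the butterfly is out of reach, and what is
    left is [triple_model]. *)
Lemma vertex_triple_line (R : realType) (M : topologicalType) (S : set M)
    (p : M) :
  true_vertices R S p -> triple_points R S !=set0.
Proof.
move=> [phi [chart _]]; exists (phi (0, 1 / 2, 0)).
exists (phi \o dilate (0, 1 / 2, 0) (1 / 4)).
apply: (local_chart_dilate _ _ chart); [exact: open_cube|lra|].
case=> -[s t] h [/= s1 t1 h1].
move: s1 t1 h1; rewrite /cube /dilate /butterfly_model /triple_model /=.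
rewrite !ltr_norml => /andP[? ?] /andP[? ?] /andP[? ?]; split.
  by split; lra.
split=> [[?|[? ?]|[? ?]]|[?|[? ?]]].
- by left; lra.
- by right; split; lra.
- by lra.
- by constructor 1; lra.
- by constructor 2; split; lra.
Qed.

(** Cell boundaries are mapped into cells of [P], so [P] is also the finite union of the images of
    the closed cells, each compact. *)
Lemma finite_CW_compact (R : realType) (M : topologicalType) (P : set M) :
  finite_CW R P -> compact P.
Proof.
move=> [n [d [Phi [cPhi _ _ PE bdry]]]].
have -> : P = \big[setU/set0]_(i < n) (Phi i @` @cell_closed R (d i)).
  rewrite PE -bigcup_seq.
  apply/seteqP; split=> p [i _].
    move=> [v vi <-]; exists i; first exact: mem_index_enum.
    by exists v => // j; exact: ltW.
  move=> [v vi <-]; have [vo|vo] := pselect (@cell_open R (d i) v).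
    by exists i => //; exists v.
  have [|j _ [w wj <-]] := bdry i (Phi i v); first by exists v.
  by exists j => //; exists w.
apply: bigsetU_compact => i _; apply: continuous_compact; first exact: cPhi.
have -> : @cell_closed R (d i) =
    [set v | forall j, `[(- 1 : R), 1]%classic (v ord0 j)].
  by apply/seteqP; split=> v vi j; have := vi j; rewrite /= in_itv/= ler_norml.
by apply: (@rV_compact R (d i) (fun=> `[(- 1 : R), 1]%classic)) => j;
  exact: segment_compact.
Qed.

Lemma homeomorphic_compact (X Y : topologicalType) (A : set X) (B : set Y) :
  homeomorphic A B -> compact A -> compact B.
Proof.
move=> [f [[fAB _ surj] cf _]] cA.
have -> : B = f @` A by apply/seteqP; split=> // _ [x Ax <-]; exact: fAB.
exact: continuous_compact.
Qed.

Lemma plane_not_compact (R : realType) : ~ compact [set: R * R].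
Proof.
move=> cR.
have [| |c _ cmax] := @compact_EVT_max _ R (fst : R * R -> R) _ _ cR.
- by exists (0, 0).
- by apply: continuous_subspaceT => q; exact: cvg_fst.
have := cmax (c.1 + 1, 0); rewrite inE => /(_ I) /=.
by rewrite gerDl ler10.
Qed.

Lemma half_open_cylinder_not_compact (R : realType) (X : topologicalType)
    (B : set X) :
  B !=set0 -> ~ compact (B `*` `[(0 : R), 1[%classic).
Proof.
move=> [b Bb] cB.
have [| |[p t] + cmax] :=
    @compact_EVT_max _ R (snd : X * R -> R) _ _ cB.
- by exists (b, 0); split=> //=; rewrite in_itv /= lexx ltr01.
- by apply: continuous_subspaceT => q; exact: cvg_snd.
rewrite inE => -[/= _]; rewrite in_itv /= => /andP[t0 t1].
have := cmax (b, (t + 1) / 2); rewrite inE /= => H.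
suff : (t + 1) / 2 <= t by lra.
by apply: H; split=> //=; rewrite in_itv /=; lra.
Qed.

(** With [S] empty, the compact [N] would be homeomorphic to its boundary times [0, 1), which forces
    the boundary of [N] to be empty. If [M] has boundary this is absurd. Otherwise [N], the
    complement of the ball, is itself empty, yet [phi (3 / 2, 0, 0)] is in the larger chart and
    outside the ball. *)
Lemma spine_nonempty (R : realType) (M : topologicalType) (S : set M) :
  compact [set: M] -> spine R S -> S !=set0.
Proof.
move=> cM spineS; apply/set0P/eqP => S0; subst S.
have closed_boundary (N : set M) : compact N -> spine_of_bounded R N set0 ->
    manifold_boundary R N = set0.
  move=> cN [_ _ homeo]; apply: contrapT => /eqP/set0P bN.
  apply: (half_open_cylinder_not_compact bN).
  by apply: (homeomorphic_compact homeo); rewrite setD0.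
case: spineS => [[bM /(closed_boundary _ cM) bM0]|[_ [phi [chart bounded]]]].
  by move: bM; rewrite bM0 => -[].
have oB : open (phi @` cube 1).
  have sub12 q : cube 1 q -> cube (2 : R) q.
    by move=> [/= *]; split=> /=; lra.
  have := @open_chart_comp R M (cube 2) (cube 1) setT phi id id.
  case=> //; try exact: open_cube; try exact: openT; try by move=> ? _; exact: cvg_id.
  by move=> q /sub12.
have cN : compact (~` (phi @` cube 1)).
  by apply: (subclosed_compact _ cM) => //; exact: open_closedC.
have bN := closed_boundary _ cN bounded.
have all_ball p : (phi @` cube 1) p.
  apply: contrapT => Np; case: bounded => _ _ [f [[fN _ _] _ _]].
  have [|] := fN p; first by split.
  by rewrite bN.
have [q q1 qE] := all_ball (phi (3 / 2, 0, 0)).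
case: chart => _ [[_ inj _] _ _].
have : q = (3 / 2, 0, 0).
  apply: inj => //; rewrite inE.
    by case: q1 => /= *; split=> /=; lra.
  by split; rewrite /= ?normr0// ger0_norm; lra.
move=> qq; case: q1; rewrite qq /= ger0_norm; lra.
Qed.

Lemma special_triple_point (R : realType) (M : topologicalType) (S : set M) :
  hausdorff_space M -> special R S -> S !=set0 -> triple_points R S !=set0.
Proof.
move=> hM [[CW strata] _ cells] [p Sp].
apply: contrapT => noT.
(* True vertices have triple points nearby, so they are excluded too. The 2-components are then the
   connected components of [S], which are closed because [S] is compact in a Hausdorff space. *)
have regE : regular_points R S = S.
  apply/seteqP; split=> q.
    by move=> [phi [[_ SX] <-]]; apply/SX => //; split; rewrite /= normr0.
  move=> /strata [[//|tq]|/vertex_triple_line//].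
  by case: noT; exists q.
have cS := finite_CW_compact CW.
have homeo : homeomorphic (connected_component S p) [set: R * R].
  by apply: cells; exists p; rewrite regE.
apply: (@plane_not_compact R); apply: (homeomorphic_compact homeo).
apply: (subclosed_compact _ cS); last exact: connected_component_sub.
exact: component_closed (compact_closed hM cS).
Qed.

Unset Implicit Arguments.
Set Strict Implicit.

Theorem mainTheorem1 (R : realType) (K : closedFieldType)
    (char2 : 2%N \in [pchar K])
    (M : topologicalType) (S : set M)
    (manifoldM : three_manifold R M)
    (compactM : compact [set: M]) (connectedM : connected [set: M])
    (specialS : special R S) (spineS : spine R S) :
  Winfty R K S = set0.
Proof.
case: manifoldM => hM _ _.
have [p [psi [chart _]]] :=
  special_triple_point hM specialS (spine_nonempty compactM spineS).
by apply/seteqP; split=> x //; exact: triple_line_Winfty char2 chart.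
Qed.
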